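(* Let $p,q\in\mathbb{N}$, $\alpha,\beta>-1$, $\lambda,\mu,r>0$ with $\alpha+\lambda\ge0$, $A_i,B_j>0$, $a_i,b_j\ge0$ ($1\le i\le p$, $1\le j\le q$). Let $\mathbf c=(c_n)_{n\ge1}$ be a real sequence with $0<c_1<c_2<\cdots$ and $c_n\uparrow\infty$, and let $c:\mathbb{R}_+\to\mathbb{R}_+$ be an increasing invertible function with $c(n)=c_n$ for all $n\in\mathbb{N}$, with inverse $c^{-1}$. For $\sigma\ge0$ let $V^{[\sigma]}$ denote the generalized Volterra function $V_{p+1,q}^{\alpha,\beta}$ with upper parameters $(a_1,A_1),\dots,(a_p,A_p),(\sigma,1)$ and lower parameters $(b_1,B_1),\dots,(b_q,B_q)$. Then the alternating Mathieu-type series $$\tilde{\mathcal K}=\sum_{j=1}^\infty\frac{(-1)^{j-1}c_j^{-\lambda}}{(c_j+r)^\mu}\,V^{[\alpha+\lambda]}\Big(\frac r{c_j}\Big)$$ has the integral representation $$\tilde{\mathcal K}=\tilde K_{\mathbf c}^V(r,\lambda+1,\mu)+\mu\,\tilde K_{\mathbf c}^V(r,\lambda,\mu+1),$$ where, for $\lambda',\mu'>0$, $$\tilde K_{\mathbf c}^V(r,\lambda',\mu')=\int_{c_1}^\infty\frac{\sin^2\!\big(\frac\pi2[c^{-1}(x)]\big)}{x^{\lambda'}(x+r)^{\mu'}}\,V^{[\alpha+\lambda']}\Big(\frac rx\Big)\,dx$$ and $[a]$ denotes the integer part of the real number $a$.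
   Context: The generalized Volterra function with upper parameters $(a_i,A_i)_{1\le i\le p}$ and lower parameters $(b_j,B_j)_{1\le j\le q}$ ($A_i,B_j>0$, $a_i,b_j\ge0$, $\alpha,\beta>-1$) is $$V_{p,q}^{\alpha,\beta}(x)=\int_0^\infty \frac{\prod_{i=1}^p\Gamma(A_it+a_i)}{\prod_{j=1}^q\Gamma(B_jt+b_j)}\,\frac{x^{t+\alpha}t^\beta}{\Gamma(\beta+1)}\,dt,\qquad x>0.$$ It is understood that the parameters and the sequence $\mathbf c$ are such that the integrals defining the generalized Volterra functions, and the series $\tilde{\mathcal K}$, converge. *)

(* Defs.v *)
From HB Require Import structures.
From mathcomp Require Import all_boot all_order all_algebra.
From mathcomp Require Import all_classical all_reals all_analysis.

Set Implicit Arguments.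
Unset Strict Implicit.
Unset Printing Implicit Defensive.

Import Order.TTheory GRing.Theory Num.Theory.
Import numFieldNormedType.Exports.

Local Open Scope classical_set_scope.
Local Open Scope ring_scope.

(* Euler's integral; it converges, hence is meaningful, only for 0 < z. *)
Definition Gamma (R : realType) (z : R) : R :=
  \int[lebesgue_measure]_(u in `]0, +oo[) (u `^ (z - 1) * expR (- u)).

(* The upper parameters (a_i, A_i) and the lower parameters (b_j, B_j) are
   passed as four tuples, in the order a, A, b, B. *)
Definition volterra_integrand (R : realType) (p q : nat)
    (a A : p.-tuple R) (b B : q.-tuple R) (alpha beta x t : R) : R :=
  (\prod_(i < p) Gamma (tnth A i * t + tnth a i))
  / (\prod_(j < q) Gamma (tnth B j * t + tnth b j))
  * (x `^ (t + alpha) * t `^ beta / Gamma (beta + 1)).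

Definition volterra_converges (R : realType) (p q : nat)
    (a A : p.-tuple R) (b B : q.-tuple R) (alpha beta x : R) : Prop :=
  (@lebesgue_measure R).-integrable `]0, +oo[
    (EFin \o volterra_integrand a A b B alpha beta x).

(* Equal to 0 by convention when the (nonnegative) integrand is not
   integrable; see [volterra_converges]. *)
Definition volterra (R : realType) (p q : nat)
    (a A : p.-tuple R) (b B : q.-tuple R) (alpha beta x : R) : R :=
  \int[lebesgue_measure]_(t in `]0, +oo[)
    volterra_integrand a A b B alpha beta x t.

(* V_{p+1,q} with the pair (sigma, 1) appended to the upper parameters. *)
Definition volterra_ext_converges (R : realType) (p q : nat)
    (a A : p.-tuple R) (b B : q.-tuple R) (alpha beta sigma x : R) : Prop :=
  volterra_converges [tuple of rcons a sigma] [tuple of rcons A 1] b B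
    alpha beta x.

Definition volterra_ext (R : realType) (p q : nat)
    (a A : p.-tuple R) (b B : q.-tuple R) (alpha beta sigma x : R) : R :=
  volterra [tuple of rcons a sigma] [tuple of rcons A 1] b B alpha beta x.

(* The sequence c_1, c_2, ... is a function on nat whose value at 0 is
   never used. *)
Definition alt_mathieu_term (R : realType) (p q : nat)
    (a A : p.-tuple R) (b B : q.-tuple R) (alpha beta : R) (cs : nat -> R)
    (lambda mu r : R) (j : nat) : R :=
  (-1) ^+ j.-1 * cs j `^ (- lambda) / (cs j + r) `^ mu
  * volterra_ext a A b B alpha beta (alpha + lambda) (r / cs j).

Definition KV_integrand (R : realType) (p q : nat)
    (a A : p.-tuple R) (b B : q.-tuple R) (alpha beta : R) (cinv : R -> R)
    (r lambda mu x : R) : R :=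
  sin (pi / 2 * (Num.floor (cinv x))%:~R) ^+ 2
  / (x `^ lambda * (x + r) `^ mu)
  * volterra_ext a A b B alpha beta (alpha + lambda) (r / x).

Definition KV_converges (R : realType) (p q : nat)
    (a A : p.-tuple R) (b B : q.-tuple R) (alpha beta : R) (cinv : R -> R)
    (c1 r lambda mu : R) : Prop :=
  (@lebesgue_measure R).-integrable `]c1, +oo[
    (EFin \o KV_integrand a A b B alpha beta cinv r lambda mu).

Definition KV (R : realType) (p q : nat)
    (a A : p.-tuple R) (b B : q.-tuple R) (alpha beta : R) (cinv : R -> R)
    (c1 r lambda mu : R) : R :=
  \int[lebesgue_measure]_(x in `]c1, +oo[)
    KV_integrand a A b B alpha beta cinv r lambda mu x.

(* Main.v *)
(** Since [Gamma (z + 1) = z * Gamma z], minus the derivative of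
    [f x = V^[alpha+lambda](r/x) / (x^lambda (x + r)^mu)] is [h1 + mu * h2],
    where [h1] and [h2] are the two K-integrands without the sine factor; by
    Tonelli, [h1 + mu * h2] integrates to [f x - f y] over [(x, y)], with no
    differentiation under the integral sign.  The sine factor is [1] on
    [[c_n, c_(n+1))] for odd [n] and [0] for even [n], so the integral over
    [(c_1, oo)] is a series with nonnegative terms
    [f c_n - f c_(n+1)], [n] odd, whose partial sums are the even partial sums
    of the alternating series; integrability of the K-integrands follows from
    the convergence of the latter. *)
Require Import Defs.
From HB Require Import structures.
From mathcomp Require Import all_boot all_order all_algebra.
From mathcomp Require Import all_classical all_reals all_analysis.
From mathcomp Require Import measurable_realfun ring.
Import Order.TTheory GRing.Theory Num.Theory.
Import numFieldNormedType.Exports.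
Local Open Scope classical_set_scope.
Local Open Scope ring_scope.

(** * The functional equation of the Gamma function *)

Lemma integral_is_derive (R : realType) (f F : R -> R) (x y : R) :
  x < y ->
  (forall z, z \in `[x, y] -> is_derive z 1 F (f z)) ->
  (forall z, z \in `[x, y] -> {for z, continuous f}) ->
  (\int[lebesgue_measure]_(z in `[x, y]) (f z)%:E = (F y - F x)%:E)%E.
Proof.
move=> xy dF cf; rewrite EFinB; apply: continuous_FTC2 => //.
- by apply: continuous_in_subspaceT => z; rewrite inE; exact: cf.
- have dFz z : z \in `[x, y] -> derivable F z 1 by move=> /dF [].
  have cF z : z \in `[x, y] -> {for z, continuous F}.
    by move=> /dFz/derivable1_diffP/differentiable_continuous.
  split => [z /subset_itv_oo_cc /dFz//||].
  + by apply: cvg_at_right_filter; apply: cF; rewrite in_itv/= lexx ltW.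
  + by apply: cvg_at_left_filter; apply: cF; rewrite in_itv/= lexx ltW.
- move=> z /subset_itv_oo_cc /dF [_ <-]; by rewrite derive1E.
Qed.

(** With [m] an integer above [|z|] and [N = n + 1], the exponential series gives
    [exp N >= N^(m+2) / (m+2)!], while [N^z <= N^(m+1)]; the quotient is thus at most
    [(m+2)! / N]. *)
Lemma powR_expRN_cvg0 (R : realType) (z : R) :
  n.+1%:R `^ z * expR (- n.+1%:R) @[n --> \oo] --> (0 : R).
Proof.
pose m := Num.bound `|z|.
apply: (@squeeze_cvgr _ _ _ _ (cst 0) (fun n => m.+2`!%:R * n.+1%:R^-1)).
- near=> n; rewrite mulr_ge0 ?powR_ge0 ?expR_ge0//= expRN.
  rewrite ler_pdivrMr ?expR_gt0// mulrAC ler_pdivlMr//.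
  apply: (@le_trans _ _ (n.+1%:R ^+ m.+2)).
    rewrite exprSr ler_wpM2r// -powR_mulrn//.
    rewrite ler_powR ?ler1n// (le_trans (ler_norm _))//.
    rewrite (le_trans (ltW (archi_boundP (normr_ge0 z))))//.
    by rewrite ler_nat.
  have := @expR_ge1Dxn R n.+1%:R m.+1 (ler0n _ _).
  move/(le_trans (ler_wpDl ler01 (lexx _))).
  by rewrite ler_pdivrMr ?ltr0n ?fact_gt0// mulrC.
- exact: cvg_cst.
- rewrite -[X in _ --> X](mulr0 (m.+2`!%:R)).
  by apply: cvgMl_tmp; exact: cvg_harmonic.
Unshelve. all: end_near. Qed.

Lemma itv0y_bigcup (R : realType) :
  `]0, +oo[%classic = \bigcup_n `[n.+1%:R^-1, n.+1%:R]%classic :> set R.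
Proof.
apply/seteqP; split => x /=; last first.
  by move=> [n _]/=; rewrite !in_itv/= => /andP[+ _]; rewrite andbT; exact: lt_le_trans.
rewrite in_itv/= andbT => x0.
pose n := maxn (Num.bound x) (Num.bound x^-1).
have bnd (y : R) m : 0 < y -> (Num.bound y <= m)%N -> y <= m.+1%:R.
  move=> y0 ym; rewrite (le_trans (ltW (archi_boundP (ltW y0))))//.
  by rewrite ler_nat leqW.
exists n => //=; rewrite in_itv/= (bnd x)// ?leq_maxl// andbT.
by rewrite invf_ple ?posrE// bnd ?invr_gt0// leq_maxr.
Qed.

(** Integration by parts on a compact interval away from the possible singularity at [0]: the
    difference of the two integrands is the derivative of [- u^z exp(-u)]. *)
Lemma Gamma_rec_itv (R : realType) (z x y : R) : 0 < x -> x < y ->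
  (\int[lebesgue_measure]_(u in `[x, y]) (u `^ z * expR (- u))%:E =
   z%:E * \int[lebesgue_measure]_(u in `[x, y]) (u `^ (z - 1) * expR (- u))%:E +
   (x `^ z * expR (- x) - y `^ z * expR (- y))%:E)%E.
Proof.
move=> x0 xy.
have gt0 u : u \in `[x, y] -> 0 < u.
  by rewrite in_itv/= => /andP[+ _]; exact: lt_le_trans.
have cf e u : u \in `[x, y] -> {for u, continuous (fun u : R => u `^ e * expR (- u))}.
  move=> /gt0 u0; apply: differentiable_continuous; apply/derivable1_diffP.
  by apply: derivableM => //; apply: derivable_powR; rewrite in_itv/= u0.
have cwf e : {within `[x, y], continuous (fun u : R => u `^ e * expR (- u))}.
  by apply: continuous_in_subspaceT => u; rewrite inE; exact: cf.
have intf e : (@lebesgue_measure R).-integrable `[x, y]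
    (EFin \o (fun u : R => u `^ e * expR (- u))).
  by apply: continuous_compact_integrable => //; exact: segment_compact.
have intz : (@lebesgue_measure R).-integrable `[x, y]
    (EFin \o (fun u : R => z * (u `^ (z - 1) * expR (- u)))).
  by apply: eq_integrable (integrableZl _ z (intf (z - 1))).
have <- : (\int[lebesgue_measure]_(u in `[x, y])
    (u `^ z * expR (- u) - z * (u `^ (z - 1) * expR (- u)))%:E =
    (x `^ z * expR (- x) - y `^ z * expR (- y))%:E)%E.
  transitivity (- (y `^ z * expR (- y)) - - (x `^ z * expR (- x)))%:E; last first.
    by congr _%:E; ring.
  apply: (@integral_is_derive _ _ (fun u => - (u `^ z * expR (- u)))) => // u uxy.
    have u0 := gt0 _ uxy.
    have dexpN : is_derive u 1 (fun u : R => expR (- u)) (- expR (- u)).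
      by apply: is_derive_eq; rewrite /GRing.scale/=; ring.
    apply: (is_derive_eq (is_deriveN (is_deriveM (is_derive1_powR z u0) dexpN))).
    by rewrite /GRing.scale/=; ring.
  apply: continuousB; first exact: cf.
  by apply: continuousM; [exact: cst_continuous|exact: cf].
under [X in _ = _ + X]eq_integral do rewrite EFinB.
rewrite integralB_EFin// -integralZl//; last exact: intf.
under [X in _ = X + _]eq_integral do rewrite -EFinM.
by rewrite addeC subeK//; apply: integrable_fin_num.
Qed.

(** Integration by parts over the intervals [[1/(n+1), n+1]], then [n] to infinity. The boundary
    term at the left end vanishes because [z > 0], the one at the right end by exponential decay. *)
Lemma Gamma_rec (R : realType) (z : R) : 0 < z -> Gamma (z + 1) = z * Gamma z.
Proof.
move=> z0; rewrite /Gamma addrK.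
pose g (e u : R) : R := u `^ e * expR (- u).
pose I n : set R := `[n.+1%:R^-1, n.+1%:R]%classic.
have nd : nondecreasing_seq I.
  move=> m n mn; rewrite subsetEset; apply: subset_itv; rewrite bnd_simp ?ler_nat//.
  by rewrite lef_pV2 ?posrE// ler_nat.
have mg e (D : set R) : measurable_fun D (g e).
  apply: measurable_funM.
    by apply: measurable_funTS; exact: measurable_powR.
  by apply: measurableT_comp => //; exact: measurable_funTS.
(* Monotone convergence, valid in the extended reals for every exponent, with no integrability to
   check. *)
have cv e : (\int[lebesgue_measure]_(u in I n) (g e u)%:E
    @[n --> \oo]%classic --> \int[lebesgue_measure]_(u in `]0%R, +oo[) (g e u)%:E)%E.
  rewrite itv0y_bigcup; apply: ge0_nondecreasing_set_cvg_integral => //.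
  - by move=> n; exact: measurable_itv.
  - by move=> n; apply/measurable_EFinP; exact: mg.
  - by move=> n u _; rewrite lee_fin mulr_ge0 ?powR_ge0 ?expR_ge0.
rewrite /Rintegral -[z in RHS]/(fine z%:E) /=.
have E : (\int[lebesgue_measure]_(u in `]0%R, +oo[) (g z u)%:E =
   z%:E * \int[lebesgue_measure]_(u in `]0%R, +oo[) (g (z - 1) u)%:E)%E.
  apply: cvg_unique (cv z) _ => //.
  (* The index starts at [1] because [I 0] is the single point [1], whereas [Gamma_rec_itv] needs
     distinct end points. *)
  have b n : (\int[lebesgue_measure]_(u in I n.+1) (g z u)%:E =
     z%:E * \int[lebesgue_measure]_(u in I n.+1) (g (z - 1) u)%:E +
     (g z n.+2%:R^-1 - g z n.+2%:R)%:E)%E.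
    apply: Gamma_rec_itv; rewrite ?invr_gt0//.
    by rewrite (@lt_trans _ _ 1)// ?invf_lt1 ?ltr1n.
  rewrite /= -cvg_shiftS /=.
  under eq_cvg do rewrite b.
  rewrite -[(z%:E * \int[lebesgue_measure]_(u in `]0%R, +oo[) _)%E]adde0.
  apply: cvgeD.
  - by rewrite fin_num_adde_defl.
  - apply: cvgeZl => //.
    rewrite (cvg_shiftS (fun n => \int[lebesgue_measure]_(u in I n) (g (z - 1) u)%:E)%E).
    exact: cv.
  apply: cvg_EFin; first exact: nearW.
  rewrite -[X in _ --> X]subr0; apply: cvgB; last first.
    by rewrite (cvg_shiftS (fun n => g z n.+1%:R)); exact: powR_expRN_cvg0.
  rewrite (cvg_shiftS (fun n => g z n.+1%:R^-1)).
  have : g z n.+1%:R^-1 @[n --> \oo] --> 0 * expR (- 0).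
    apply: cvgM.
      have /cvg_at_rightP := powR_cvg0 z0; apply; split; last exact: cvg_harmonic.
      by move=> n; rewrite invr_gt0.
    apply: continuous_cvg; first exact: continuous_expR.
    by apply: cvgN; exact: cvg_harmonic.
  by rewrite mul0r.
rewrite [X in fine X = _]E.
(* Convergence of Euler's integral is not established: were its value infinite, both sides would be
   [0], the default value of [fine] at infinity. *)
have [/eqP->|I0] := boolP ((\int[lebesgue_measure]_(u in `]0%R, +oo[) (g (z - 1) u)%:E)%E == +oo%E).
  by rewrite gt0_muley ?lte_fin//= mulr0.
rewrite fineM// fin_numE I0 andbT gt_eqF// (@lt_le_trans _ _ 0%E)//.
by apply: integral_ge0 => u _; rewrite lee_fin mulr_ge0 ?powR_ge0 ?expR_ge0.
Qed.

(** * Measurability of powers and Tonelli's theorem on rectangles *)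

(** A power with positive base is [exp (g ln f)]; positivity avoids the separate case of base [0] in
    the definition of the power. *)
Lemma measurable_fun_powR2 (R : realType) (d : measure_display)
    (T : measurableType d) (D : set T) (f g : T -> R) :
  measurable D -> measurable_fun D f -> measurable_fun D g ->
  (forall x, D x -> 0 < f x) -> measurable_fun D (fun x => f x `^ g x).
Proof.
move=> mD mf mg f0; apply: (@eq_measurable_fun _ _ _ _ _ (fun x => expR (g x * ln (f x)))).
  by move=> x /set_mem /f0 fx0; rewrite /powR gt_eqF.
apply: measurableT_comp => //; apply: measurable_funM => //.
by apply: measurableT_comp => //; exact: measurable_ln.
Qed.

Section tonelli_setX.
Context (R : realType) (A B : set R) (f : R -> R -> R).
Context (mA : measurable A) (mB : measurable B).
Context (mf : measurable_fun (A `*` B) (fun z => f z.1 z.2)).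
Context (f0 : forall x y, A x -> B y -> 0 <= f x y).
Let mu := @lebesgue_measure R.

(** Extension by zero to the whole plane, so that Tonelli's theorem for the full product space
    applies while measurability and sign are required on the rectangle only. *)
Let F : R * R -> \bar R := (fun z => (f z.1 z.2)%:E) \_ (A `*` B).

Let mF : measurable_fun setT F.
Proof.
apply/(measurable_restrictT _ (measurableX mA mB)).
exact/measurable_EFinP.
Qed.

Let F0 z : (0 <= F z)%E.
Proof.
by apply: erestrict_ge0 => -[x y] [/= Ax By]; rewrite lee_fin; exact: f0.
Qed.

Let intF2 x : (\int[mu]_y F (x, y) = ((fun x => \int[mu]_(y in B) (f x y)%:E) \_ A) x)%E.
Proof.
rewrite patchE; case: ifPn => xA; last first.
  by apply: integral0_eq => y _; rewrite /F patchE in_setX (negbTE xA).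
rewrite [RHS]integral_mkcond; apply: eq_integral => y _.
by rewrite /F !patchE in_setX xA.
Qed.

Let intF1 y : (\int[mu]_x F (x, y) = ((fun y => \int[mu]_(x in A) (f x y)%:E) \_ B) y)%E.
Proof.
rewrite patchE; case: ifPn => yB; last first.
  by apply: integral0_eq => x _; rewrite /F patchE in_setX (negbTE yB) andbF.
rewrite [RHS]integral_mkcond; apply: eq_integral => x _.
by rewrite /F !patchE in_setX yB andbT.
Qed.

Lemma tonelli_setX :
  (\int[mu]_(x in A) \int[mu]_(y in B) (f x y)%:E =
   \int[mu]_(y in B) \int[mu]_(x in A) (f x y)%:E)%E.
Proof.
have := @fubini_tonelli _ _ _ _ _ mu mu F mF F0.
under eq_integral do rewrite intF2.
under [X in _ = X -> _]eq_integral do rewrite intF1.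
by rewrite -!integral_mkcond.
Qed.

Lemma measurable_fun_integral_setX :
  measurable_fun A (fun x => \int[mu]_(y in B) (f x y)%:E)%E.
Proof.
apply/(measurable_restrictT _ mA).
rewrite (_ : _ \_ _ = fubini_F mu F); first exact: measurable_fun_fubini_tonelli_F.
by apply/funext => x; rewrite -intF2.
Qed.

End tonelli_setX.

(** * Mellin-type transforms and integration of their derivatives *)

(** The form taken by [V^[alpha+lambda](r/x) / x^lambda] for a suitable weight and
    [L = alpha + lambda]. All dependence on [x] is in one power, so minus the formal derivative
    multiplies the weight by [t + L] and raises [L] by one. *)
Definition mellin {R : realType} (w : R -> R) (L x : R) : R :=
  \int[lebesgue_measure]_(t in `]0, +oo[) (w t * x `^ (- (t + L))).

Lemma measurable_fun_mellin (R : realType) (w : R -> R) (L : R) (A : set R) :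
  measurable A -> (forall x, A x -> 0 < x) ->
  measurable_fun (`]0, +oo[ : set R) w -> (forall t, 0 < t -> 0 <= w t) ->
  measurable_fun A (mellin w L).
Proof.
move=> mA A0 mw w0; apply: measurableT_comp => //.
apply: (@measurable_fun_integral_setX _ _ _ (fun x t => w t * x `^ (- (t + L)))) => //.
- apply: measurable_funM.
    apply: (@measurable_comp _ _ _ _ _ _ (`]0, +oo[ : set R) w _ snd) => //;
      last exact: measurable_funTS.
    by move=> _ [[x t] [/= _ t0] <-].
  apply: measurable_fun_powR2.
  + exact: measurableX.
  + exact: measurable_funTS.
  + by apply: measurableT_comp => //; apply: measurable_funD => //; exact: measurable_funTS.
  + by move=> [x t] [/= Ax _]; exact: A0.
- by move=> x t _ /=; rewrite in_itv/= andbT => t0; rewrite mulr_ge0 ?powR_ge0 ?w0.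
Qed.

Lemma measurable_powR_kernel (R : realType) (s mu r : R) (E : set R) :
  measurable_fun E (fun u => s * u `^ (- (s + 1)) * (u + r) `^ (- mu)
    + mu * (u `^ (- s) * (u + r) `^ (- (mu + 1)))).
Proof.
have mp e : measurable_fun E (fun u : R => u `^ e).
  by apply: measurable_funTS; exact: measurable_powR.
have mr e : measurable_fun E (fun u : R => (u + r) `^ e).
  have ma : measurable_fun setT (fun u : R => u + r) by exact: measurable_funD.
  by apply: measurable_funTS; exact: (measurableT_comp (measurable_powR e) ma).
by apply: measurable_funD; apply: measurable_funM => //; apply: measurable_funM.
Qed.

(** The integrand is minus the derivative of [u^(-s) (u + r)^(-mu)]. With [s = t + L] this is the
    contribution of a single [t] to the integral of a Mellin-type transform. *)
Lemma integral_powR_kernel (R : realType) (s mu r x y : R) :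
  0 < r -> 0 < x -> x < y ->
  (\int[lebesgue_measure]_(u in `]x, y[)
     (s * u `^ (- (s + 1)) * (u + r) `^ (- mu)
      + mu * (u `^ (- s) * (u + r) `^ (- (mu + 1))))%:E =
   (x `^ (- s) * (x + r) `^ (- mu) - y `^ (- s) * (y + r) `^ (- mu))%:E)%E.
Proof.
move=> r0 x0 xy.
have gt0 u : u \in `[x, y] -> 0 < u.
  by rewrite in_itv/= => /andP[+ _]; exact: lt_le_trans.
have dr e u : u \in `[x, y] ->
    is_derive u 1 (fun u : R => (u + r) `^ e) (e * (u + r) `^ (e - 1)).
  move=> /gt0 u0.
  have dp := is_derive1_powR e (addr_gt0 u0 r0).
  have da : is_derive u 1 (fun u : R => u + r) 1.
    by apply: is_derive_eq; rewrite addr0.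
  have := @is_derive1_comp _ (fun v : R => v `^ e) (fun u : R => u + r) _ _ _ dp da.
  by rewrite mulr1.
have cp e u : u \in `[x, y] -> {for u, continuous (fun u : R => u `^ e)}.
  move=> /gt0 u0; apply: differentiable_continuous; apply/derivable1_diffP.
  by apply: derivable_powR; rewrite in_itv/= u0.
have cr e u : u \in `[x, y] -> {for u, continuous (fun u : R => (u + r) `^ e)}.
  by move=> /(dr e)[+ _] => /derivable1_diffP/differentiable_continuous.
(* The end points form a null set; the fundamental theorem is applied on the closed interval. *)
rewrite -(@integral_itv_bndoo _ _ _ _ true false); last first.
  apply/measurable_EFinP; exact: measurable_powR_kernel.
transitivity (- (y `^ (- s) * (y + r) `^ (- mu))
    - - (x `^ (- s) * (x + r) `^ (- mu)))%:E; last first.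
  by congr _%:E; ring.
apply: (@integral_is_derive _ _ (fun u => - (u `^ (- s) * (u + r) `^ (- mu)))) => // u uxy.
  apply: (is_derive_eq (is_deriveN
    (is_deriveM (is_derive1_powR (- s) (gt0 _ uxy)) (dr (- mu) _ uxy)))).
  by rewrite /GRing.scale/= !opprD; ring.
apply: continuousD; apply: continuousM.
- by apply: continuousM; [exact: cst_continuous|exact: cp].
- exact: cr.
- exact: cst_continuous.
- by apply: continuousM; [exact: cp|exact: cr].
Qed.

(** The kernel identity is integrated against [w], and Tonelli applies since [t + L >= 0]. The
    interval is open because the transform with the extra factor [t + L] is assumed to converge only
    strictly to the right of [x]. *)
Lemma integral_mellinM (R : realType) (w : R -> R) (L mu r x y : R) :
  0 <= L -> 0 < r -> 0 < x -> x < y ->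
  measurable_fun (`]0, +oo[ : set R) w -> (forall t, 0 < t -> 0 <= w t) ->
  (forall z, x <= z -> (@lebesgue_measure R).-integrable `]0, +oo[
     (EFin \o fun t => w t * z `^ (- (t + L)))) ->
  (forall z, x < z -> (@lebesgue_measure R).-integrable `]0, +oo[
     (EFin \o fun t => (t + L) * w t * z `^ (- (t + (L + 1))))) ->
  0 < mu ->
  (\int[lebesgue_measure]_(u in `]x, y[)
     (mellin (fun t => (t + L) * w t) (L + 1) u * (u + r) `^ (- mu)
      + mu * (mellin w L u * (u + r) `^ (- (mu + 1))))%:E =
   (mellin w L x * (x + r) `^ (- mu) - mellin w L y * (y + r) `^ (- mu))%:E)%E.
Proof.
move=> L0 r0 x0 xy mw w0 iw iw1 mu0.
pose D t u := (t + L) * u `^ (- (t + L + 1)) * (u + r) `^ (- mu)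
  + mu * (u `^ (- (t + L)) * (u + r) `^ (- (mu + 1))).
have D0 t u : 0 < t -> 0 <= D t u.
  move=> t0; have tL : 0 <= t + L by rewrite addr_ge0// ltW.
  by rewrite addr_ge0// !mulr_ge0 ?powR_ge0// ltW.
have y0 := lt_trans x0 xy.
have iwM z m : x <= z -> (@lebesgue_measure R).-integrable `]0, +oo[
    (EFin \o fun t => w t * z `^ (- (t + L)) * m).
  move=> xz; apply: eq_integrable (integrableZr _ m (iw z xz)) => //.
(* The two transforms merge into a single integral in [t]; the integrability hypotheses are what
   allows passing from real to extended integrals here. *)
transitivity (\int[lebesgue_measure]_(u in `]x, y[)
    \int[lebesgue_measure]_(t in `]0%R, +oo[) (w t * D t u)%:E)%E.
  apply: eq_integral => u; rewrite inE/= => uxy.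
  have xu : x < u by move: uxy; rewrite in_itv/= => /andP[].
  have u0 := lt_trans x0 xu.
  rewrite /mellin -!RintegralZr//; last 2 first.
    exact: iw (ltW xu).
    exact: iw1.
  rewrite -RintegralZl//; last exact/iwM/ltW.
  have i1 : (@lebesgue_measure R).-integrable `]0, +oo[ (EFin \o fun t =>
      (t + L) * w t * u `^ (- (t + (L + 1))) * (u + r) `^ (- mu)).
    by apply: eq_integrable (integrableZr _ ((u + r) `^ (- mu)) (iw1 u xu)).
  have i2 : (@lebesgue_measure R).-integrable `]0, +oo[ (EFin \o fun t =>
      mu * (w t * u `^ (- (t + L)) * (u + r) `^ (- (mu + 1)))).
    by apply: eq_integrable (integrableZl _ mu (iwM u ((u + r) `^ (- (mu + 1))) (ltW xu))).
  rewrite -RintegralD// /Rintegral fineK; last first.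
    by apply: integrable_fin_num => //; apply: eq_integrable (integrableD _ i1 i2).
  by apply: eq_integral => t _; congr _%:E; rewrite /D addrA; ring.
rewrite (@tonelli_setX _ _ _ (fun u t => w t * D t u))//; last 2 first.
- have mpow (f e : R * R -> R) : measurable_fun setT f -> measurable_fun setT e ->
      (forall z, x < z.1 -> 0 < f z) ->
      measurable_fun (`]x, y[ `*` `]0, +oo[ : set (R * R)) (fun z => f z `^ e z).
    move=> mf me f0; apply: measurable_fun_powR2; [exact: measurableX|exact: measurable_funTS..|].
    by move=> [u t] /= [+ _]; rewrite in_itv/= => /andP[xu _]; exact: f0.
  apply: measurable_funM.
    apply: (@measurable_comp _ _ _ _ _ _ (`]0, +oo[ : set R) w _ snd) => //.
      by move=> _ [[u t] [/= _ t0] <-].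
    exact: measurable_funTS.
  apply: measurable_funD.
    apply: measurable_funM; first apply: measurable_funM.
    + by apply: measurable_funTS; apply: measurable_funD.
    + apply: mpow => [//||z xz]; last exact: lt_trans x0 xz.
      by apply: measurableT_comp => //; do 2 apply: measurable_funD => //.
    + apply: mpow => [||z xz]; last by rewrite addr_gt0// (lt_trans x0 xz).
        exact: measurable_funD.
      exact: measurable_cst.
  apply: measurable_funM; first exact: measurable_cst.
  apply: measurable_funM.
  + apply: mpow => [//||z xz]; last exact: lt_trans x0 xz.
    by apply: measurableT_comp => //; apply: measurable_funD => //.
  + apply: mpow => [||z xz]; last by rewrite addr_gt0// (lt_trans x0 xz).
      exact: measurable_funD.
    exact: measurable_cst.
- move=> u t /= _; rewrite in_itv/= andbT => t0; rewrite mulr_ge0 ?w0// D0//.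
(* After the exchange, the inner integral in [u] is evaluated by the kernel identity with
   [s = t + L]; both boundary terms are integrable in [t], so their difference may be split. *)
transitivity (\int[lebesgue_measure]_(t in `]0%R, +oo[)
   ((w t * x `^ (- (t + L)) * (x + r) `^ (- mu))%:E
    - (w t * y `^ (- (t + L)) * (y + r) `^ (- mu))%:E))%E; last first.
  rewrite integralB_EFin//; [|exact: iwM|exact/iwM/ltW].
  rewrite /mellin -!RintegralZr//; [|exact/iw/ltW|exact: iw].
  rewrite /Rintegral EFinB !fineK//; apply: integrable_fin_num => //.
  + exact/iwM/ltW.
  + exact: iwM.
apply: eq_integral => t; rewrite inE/= in_itv/= andbT => t0.
under eq_integral do rewrite EFinM.
rewrite ge0_integralZl_EFin//.
- by rewrite integral_powR_kernel// -EFinM -EFinB; congr _%:E; ring.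
- by move=> u _; rewrite lee_fin D0.
- apply/measurable_EFinP; exact: measurable_powR_kernel.
- exact: w0.
Qed.

(** Each even [k] contributes the consecutive terms [k] and [k + 1] of the alternating sum; the
    length is even so that the last pair is complete. *)
Lemma sum_double_alternating (R : realType) (v : nat -> R) (n : nat) :
  \sum_(0 <= k < n.*2) (~~ odd k)%:R * (v k - v k.+1) =
  \sum_(0 <= k < n.*2) (-1) ^+ k * v k.
Proof.
elim: n => [|n IH]; first by rewrite !big_geq.
rewrite doubleS !big_nat_recr//= IH odd_double/= !exprS -mul2n exprM sqrrN expr1n expr1n.
by ring.
Qed.

(** * Integration against a step function alternating between 1 and 0 *)

Section step_integral.
Context (R : realType) (f h S : R -> R) (d : nat -> R) (K : R).
Let mu := @lebesgue_measure R.
Context (d_lt : forall n, d n < d n.+1) (d_oo : d n @[n --> \oo] --> +oo).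
Context (mh : measurable_fun (`]d 0%N, +oo[ : set R) h).
Context (h0 : forall x, d 0%N < x -> 0 <= h x).
Context (inth : forall n,
  (\int[mu]_(x in `]d n, d n.+1[) (h x)%:E = (f (d n) - f (d n.+1))%:E)%E).
Context (SE : forall n x, d n <= x -> x < d n.+1 -> S x = (~~ odd n)%:R).
Context (cvgK : \sum_(0 <= k < n) (-1) ^+ k * f (d k) @[n --> \oo] --> K).

Let d_le m n : (m <= n)%N -> d m <= d n.
Proof. by move=> mn; apply: (nondecreasing_seqP d).1 => // k; exact: ltW. Qed.

(** Half-open cells tile the half-line without overlap; the intersection only removes the point
    [d 0] from the first cell, the domain being open there. *)
Let I n : set R := `]d 0%N, +oo[ `&` `[d n, d n.+1[.

Let mI n : measurable (I n).
Proof. by apply: measurableI; exact: measurable_itv. Qed.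

Let bigcupI : `]d 0%N, +oo[%classic = \bigcup_n I n.
Proof.
apply/seteqP; split => x; last by move=> [n _ []].
move=> xd; have [N xN] : exists n, x < d n.
  by have /cvgryPgt/(_ x)[N _ /(_ N (leqnn N))] := d_oo; exists N.
have ex : exists n, x < d n by exists N.
(* The least index with [x < d n] is not [0], and its predecessor names the cell of [x]. *)
case: (ex_minnP ex) => -[|n] xn nmin.
  by move: xd; rewrite /= in_itv/= andbT => /(lt_trans xn); rewrite ltxx.
exists n => //; split => //=; rewrite in_itv/= xn andbT leNgt.
by apply/negP => /nmin; rewrite ltnn.
Qed.

Let trivI : trivIset setT I.
Proof.
apply/trivIsetP => i j _ _.
wlog ij : i j / (i < j)%N.
  move=> H; case: (ltngtP i j) => [ij|ji|//] _.
    by apply: H; rewrite ?ltn_eqF.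
  by rewrite setIC; apply: H; rewrite ?ltn_eqF.
move=> _; apply/seteqP; split => // x [[_ /=] + [_ /=]].
rewrite !in_itv/= => /andP[_ xi] /andP[jx _].
by have := lt_le_trans xi (le_trans (d_le _ _ ij) jx); rewrite ltxx.
Qed.

Let mhI n D : D `<=` I n -> measurable_fun D h.
Proof. by move=> DI; apply: measurable_funS mh => // x /DI []. Qed.

Let intI n : (\int[mu]_(x in I n) (h x)%:E = (f (d n) - f (d n.+1))%:E)%E.
Proof.
rewrite -inth; case: n => [|n].
  congr (integral _ _ _); apply/seteqP; split => x; rewrite /I/= !in_itv/=.
    by rewrite andbT => -[-> /andP[_]].
  by move=> /andP[x0 ->]; rewrite x0 ltW.
rewrite (_ : I n.+1 = `[d n.+1, d n.+2[%classic).
  rewrite integral_itv_bndoo//; apply/measurable_EFinP; apply: (mhI n.+1).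
  move=> x; rewrite /I/= !in_itv/= => /andP[nx ->]; rewrite (ltW nx) !andbT.
  by split => //; exact: le_lt_trans (d_le 0%N n.+1 isT) nx.
apply/seteqP; split => x; rewrite /I/= !in_itv/=; first by case.
move=> /andP[nx ->]; rewrite nx !andbT; split => //.
by rewrite (lt_le_trans _ nx)// (le_lt_trans _ (d_lt n))// d_le.
Qed.

Let SI n x : I n x -> S x = (~~ odd n)%:R.
Proof. by move=> [_ /=]; rewrite in_itv/= => /andP[]; exact: SE. Qed.

(** Measurability is not a hypothesis on [S]: it follows from [S] being constant on each of
    countably many measurable cells. *)
Lemma measurable_fun_step : measurable_fun (`]d 0%N, +oo[ : set R) S.
Proof.
rewrite bigcupI; apply/measurable_fun_bigcup => n; first exact: mI.
apply: (eq_measurable_fun (cst ((~~ odd n)%:R : R))); last exact: measurable_cst.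
by move=> x /set_mem /SI.
Qed.

Lemma integral_stepM : (\int[mu]_(x in `]d 0%N, +oo[) (S x * h x)%:E = K%:E)%E.
Proof.
have Sh0 x : (d 0%N < x)%R -> (0 <= (S x * h x)%:E)%E.
  move=> x0; rewrite lee_fin mulr_ge0 ?h0//.
  have : (\bigcup_n I n) x by rewrite -bigcupI /= in_itv/= x0.
  by move=> [n _ /SI ->].
rewrite bigcupI ge0_integral_bigcup//=; last 2 first.
- rewrite -bigcupI; apply/measurable_EFinP; apply: measurable_funM => //.
  exact: measurable_fun_step.
- by move=> x; rewrite -bigcupI /= in_itv/= andbT; exact: Sh0.
have E n : (\int[mu]_(x in I n) (S x * h x)%:E =
    ((~~ odd n)%:R * (f (d n) - f (d n.+1)))%:E)%E.
  rewrite EFinM -intI -ge0_integralZl_EFin//.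
  - by apply: eq_integral => x /set_mem /SI ->.
  - exact: mI.
  - by move=> x [/=]; rewrite in_itv/= andbT => /h0.
  - by apply/measurable_EFinP; exact: (mhI n).
(* Nonnegative terms make the partial sums converge in the extended reals, so their limit can be
   identified along even indices, where they equal partial sums of the alternating series. *)
have cv : cvgn (fun n => \sum_(0 <= k < n) \int[mu]_(x in I k) (S x * h x)%:E)%E.
  apply: is_cvg_nneseries => n _ _; apply: integral_ge0 => x [/=].
  by rewrite in_itv/= andbT => /Sh0.
have d2 : n.*2 @[n --> \oo] --> \oo.
  apply/cvgnyPge => M; exists M => // n /= Mn.
  by rewrite (leq_trans Mn)// -addnn leq_addr.
pose u n := (\sum_(0 <= k < n) \int[mu]_(x in I k) (S x * h x)%:E)%E.
have cv2 : u n.*2 @[n --> \oo] --> limn u by exact: (cvg_comp _ _ d2 cv).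
apply: cvg_unique cv2 _ => //=.
have -> : (fun n => u n.*2) = EFin \o (fun n => \sum_(0 <= k < n.*2) (-1) ^+ k * f (d k)).
  apply/funext => n; rewrite /u/= -sum_double_alternating -sumEFin.
  by apply: eq_bigr => k _; exact: E.
by apply: cvg_EFin; [exact: nearW|exact: (cvg_comp _ _ d2 cvgK)].
Qed.

End step_integral.

(** A shift by [pi / 2] turns [sin^2] into [1 - sin^2], so the value flips with the parity of
    [n]. *)
Lemma sin_sqr_half_pi (R : realType) (n : nat) :
  sin (pi / 2 * n%:R) ^+ 2 = (odd n)%:R :> R.
Proof.
elim: n => [|n IH]; first by rewrite mulr0 sin0 expr0n.
rewrite -[n.+1%:R]natr1 mulrDr mulr1 sinDpihalf cos2sin2 IH oddS.
by case: odd; rewrite ?subrr ?subr0.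
Qed.

(** * Volterra functions as Mellin-type transforms *)

(** The integrand of [V^[sigma](r/x)] with the power of [x] removed and the power of [r] kept. *)
Definition volterra_weight {R : realType} {p q : nat} (a A : p.-tuple R)
    (b B : q.-tuple R) (alpha beta sigma r t : R) : R :=
  (\prod_(i < p) Gamma (tnth A i * t + tnth a i)) * Gamma (t + sigma)
  / (\prod_(j < q) Gamma (tnth B j * t + tnth b j))
  * (r `^ (t + alpha) * t `^ beta / Gamma (beta + 1)).

Lemma tnth_rcons_widen (T : Type) (p : nat) (s : p.-tuple T) (x : T) (i : 'I_p) :
  tnth [tuple of rcons s x] (widen_ord (leqnSn p) i) = tnth s i.
Proof. by rewrite !(tnth_nth x)/= nth_rcons size_tuple ltn_ord. Qed.

Lemma tnth_rcons_max (T : Type) (p : nat) (s : p.-tuple T) (x : T) :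
  tnth [tuple of rcons s x] ord_max = x.
Proof. by rewrite (tnth_nth x)/= nth_rcons size_tuple ltnn eqxx. Qed.

Lemma Gamma_ge0 (R : realType) (z : R) : 0 <= Gamma z.
Proof. by apply: Rintegral_ge0 => u _; rewrite mulr_ge0 ?powR_ge0 ?expR_ge0. Qed.

Section volterra_mellin.
Context (R : realType) (p q : nat) (a A : p.-tuple R) (b B : q.-tuple R).
Context (alpha beta r : R).
Let w := volterra_weight a A b B alpha beta.

Lemma volterra_weight_ge0 sigma t : 0 <= w sigma r t.
Proof.
rewrite /w/volterra_weight; apply: mulr_ge0; last first.
  by rewrite divr_ge0 ?mulr_ge0 ?powR_ge0 ?Gamma_ge0.
by rewrite divr_ge0 ?mulr_ge0 ?prodr_ge0 ?Gamma_ge0// => i _; exact: Gamma_ge0.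
Qed.

(** The functional equation of Gamma enters here: raising [sigma] by one produces exactly the factor
    [t + sigma] that comes from differentiating [x^(-(t + sigma))]. *)
Lemma volterra_weight_rec sigma t :
  0 < t -> 0 <= sigma -> w (sigma + 1) r t = (t + sigma) * w sigma r t.
Proof.
move=> t0 s0; rewrite /w /volterra_weight addrA (Gamma_rec _ (t + sigma)) ?ltr_wpDr//; ring.
Qed.

Lemma volterra_integrandE lambda x t : 0 < r -> 0 < x ->
  volterra_integrand [tuple of rcons a (alpha + lambda)] [tuple of rcons A 1]
    b B alpha beta (r / x) t =
  x `^ lambda * (w (alpha + lambda) r t * x `^ (- (t + (alpha + lambda)))).
Proof.
move=> r0 x0; rewrite /volterra_integrand /w /volterra_weight big_ord_recr/=.
rewrite !tnth_rcons_max mul1r.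
under eq_bigr do rewrite !tnth_rcons_widen.
rewrite powRM ?invr_ge0 ?ltW// -(powR_inv1 (ltW x0)) -powRrM.
rewrite (_ : -1 * (t + alpha) = lambda + - (t + (alpha + lambda))); last by ring.
rewrite (@powRD _ x); last by apply/implyP => _; rewrite gt_eqF.
by ring.
Qed.

Lemma volterra_integrable lambda x : 0 < r -> 0 < x ->
  volterra_ext_converges a A b B alpha beta (alpha + lambda) (r / x) ->
  (@lebesgue_measure R).-integrable `]0, +oo[
    (EFin \o fun t => w (alpha + lambda) r t * x `^ (- (t + (alpha + lambda)))).
Proof.
move=> r0 x0 cV.
apply: eq_integrable (integrableZl _ (x `^ (- lambda)) cV) => // t _.
rewrite /= volterra_integrandE// -EFinM.
by rewrite [x `^ (- lambda)]powRN mulKf// gt_eqF ?powR_gt0.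
Qed.

Lemma mellin_volterra lambda x : 0 < r -> 0 < x ->
  volterra_ext_converges a A b B alpha beta (alpha + lambda) (r / x) ->
  mellin (w (alpha + lambda) r) (alpha + lambda) x =
  volterra_ext a A b B alpha beta (alpha + lambda) (r / x) / x `^ lambda.
Proof.
move=> r0 x0 cV; rewrite /volterra_ext /volterra /mellin.
under [in RHS]eq_Rintegral do rewrite volterra_integrandE//.
rewrite RintegralZl//; last exact: volterra_integrable.
by rewrite mulrC mulKf// gt_eqF ?powR_gt0.
Qed.

(** Convergence at a single [x] already contains measurability of the integrand; multiplying back by
    a power of [x] frees the weight, with no study of the Gamma factors. *)
Lemma measurable_volterra_weight lambda x : 0 < r -> 0 < x ->
  volterra_ext_converges a A b B alpha beta (alpha + lambda) (r / x) ->
  measurable_fun (`]0, +oo[ : set R) (w (alpha + lambda) r).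
Proof.
move=> r0 x0 /volterra_integrable -/(_ r0 x0)/measurable_int/measurable_EFinP mw.
have mx : measurable_fun setT (fun t : R => x `^ (t + (alpha + lambda))).
  apply: (measurableT_comp (measurable_powRr x)); exact: measurable_funD.
have mm : measurable_fun (`]0, +oo[ : set R) (fun t : R =>
    w (alpha + lambda) r t * x `^ (- (t + (alpha + lambda)))
    * x `^ (t + (alpha + lambda))).
  by apply: measurable_funM; [exact: mw|exact: measurable_funTS].
apply: eq_measurable_fun mm => t _ /=.
by rewrite powRN mulfVK// gt_eqF ?powR_gt0.
Qed.

End volterra_mellin.

(** * Assembly of the integral representation *)

Theorem theorem6 (R : realType) (p q : nat) (alpha beta lambda mu r : R)
    (a A : p.-tuple R) (b B : q.-tuple R)
    (cs : nat -> R) (c cinv : R -> R)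
    (halpha : -1 < alpha) (hbeta : -1 < beta)
    (hlambda : 0 < lambda) (hmu : 0 < mu) (hr : 0 < r)
    (halphalambda : 0 <= alpha + lambda)
    (hA : forall i : 'I_p, 0 < tnth A i) (ha : forall i : 'I_p, 0 <= tnth a i)
    (hB : forall j : 'I_q, 0 < tnth B j) (hb : forall j : 'I_q, 0 <= tnth b j)
    (hcs1 : 0 < cs 1%N)
    (hcs_lt : forall n : nat, (1 <= n)%N -> cs n < cs n.+1)
    (hcs_oo : cs n @[n --> \oo] --> +oo)
    (hc_incr : forall x y : R, 0 <= x -> x < y -> c x < c y)
    (hc_bij : set_bij `[0, +oo[ `[0, +oo[ c)
    (hcinv : forall x : R, 0 <= x -> cinv (c x) = x)
    (hc_cs : forall n : nat, (1 <= n)%N -> c n%:R = cs n)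
    (hV : forall x : R, cs 1%N <= x ->
       volterra_ext_converges a A b B alpha beta (alpha + lambda) (r / x))
    (hV1 : forall x : R, cs 1%N < x ->
       volterra_ext_converges a A b B alpha beta (alpha + (lambda + 1)) (r / x))
    (hK : cvgn (fun n : nat =>
       \sum_(1 <= j < n)
         alt_mathieu_term a A b B alpha beta cs lambda mu r j)) :
  [/\ KV_converges a A b B alpha beta cinv (cs 1%N) r (lambda + 1) mu,
      KV_converges a A b B alpha beta cinv (cs 1%N) r lambda (mu + 1) &
      \big[+%R/0]_(1 <= j <oo) alt_mathieu_term a A b B alpha beta cs lambda mu r j
      = KV a A b B alpha beta cinv (cs 1%N) r (lambda + 1) mu
        + mu * KV a A b B alpha beta cinv (cs 1%N) r lambda (mu + 1)].
Proof.
pose L := alpha + lambda; pose w := volterra_weight a A b B alpha beta L r.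
pose w1 t := (t + L) * w t.
(* Indices are shifted so that [d 0] is [c_1]: odd indices of [c] become even indices of [d]. *)
pose d n := cs n.+1.
have d_lt n : d n < d n.+1 by exact: hcs_lt.
have d_oo : d n @[n --> \oo] --> +oo by rewrite (cvg_shiftS cs).
have d_ge n : d 0%N <= d n.
  by apply: (nondecreasing_seqP d).1 => // k; exact: ltW.
have d_gt0 x : d 0%N <= x -> 0 < x by exact: lt_le_trans.
have w_ge0 t : 0 < t -> 0 <= w t by move=> _; exact: volterra_weight_ge0.
have w1_ge0 t : 0 < t -> 0 <= w1 t.
  by move=> t0; rewrite mulr_ge0 ?w_ge0// addr_ge0// ltW.
have mw : measurable_fun (`]0, +oo[ : set R) w.
  by apply: (@measurable_volterra_weight _ _ _ _ _ _ _ _ _ _ _ (d 0%N)) => //; exact: hV.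
have mw1 : measurable_fun (`]0, +oo[ : set R) w1.
  by apply: measurable_funM => //; apply: measurable_funD.
have L1 : alpha + (lambda + 1) = L + 1 by rewrite /L addrA.
have w1E t : 0 < t -> volterra_weight a A b B alpha beta (alpha + (lambda + 1)) r t = w1 t.
  by move=> t0; rewrite L1; exact: volterra_weight_rec.
have iw x : d 0%N <= x -> (@lebesgue_measure R).-integrable `]0, +oo[
    (EFin \o fun t => w t * x `^ (- (t + L))).
  by move=> dx; apply: volterra_integrable => //; [exact: d_gt0|exact: hV].
have iw1 x : d 0%N < x -> (@lebesgue_measure R).-integrable `]0, +oo[
    (EFin \o fun t => (t + L) * w t * x `^ (- (t + (L + 1)))).
  move=> dx; have x0 := d_gt0 _ (ltW dx).
  apply: eq_integrable (@volterra_integrable _ _ _ _ _ _ _ _ _ _ _ _ hr x0 (hV1 _ dx)) => // t.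
  by rewrite inE/= in_itv/= andbT => t0; rewrite w1E// L1.
have VE x : d 0%N <= x -> volterra_ext a A b B alpha beta L (r / x) / x `^ lambda = mellin w L x.
  by move=> dx; rewrite mellin_volterra//; [exact: d_gt0|exact: hV].
have VE1 x : d 0%N < x ->
    volterra_ext a A b B alpha beta (alpha + (lambda + 1)) (r / x) / x `^ (lambda + 1) =
    mellin w1 (L + 1) x.
  move=> dx; rewrite -mellin_volterra//; [|exact/d_gt0/ltW|exact: hV1].
  apply: eq_Rintegral => t; rewrite inE/= in_itv/= andbT => t0.
  by rewrite w1E// L1.
pose S x := sin (pi / 2 * (Num.floor (cinv x))%:~R) ^+ 2 : R.
(* [f (d k)] is the series term of index [k + 1] without its sign. *)
pose f x := mellin w L x * (x + r) `^ (- mu).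
pose h1 x := mellin w1 (L + 1) x * (x + r) `^ (- mu).
pose h2 x := mellin w L x * (x + r) `^ (- (mu + 1)).
pose h x := h1 x + mu * h2 x.
pose D : set R := `]d 0%N, +oo[%classic.
have mD : measurable D by exact: measurable_itv.
have D0 x : D x -> 0 < x by rewrite /D/= in_itv/= andbT => /ltW/d_gt0.
have mr e : measurable_fun D (fun x => (x + r) `^ e).
  have ma : measurable_fun setT (fun u : R => u + r) by exact: measurable_funD.
  by apply: measurable_funTS; exact: (measurableT_comp (measurable_powR e) ma).
have mh1 : measurable_fun D h1.
  by apply: measurable_funM => //; exact: measurable_fun_mellin.
have mh2 : measurable_fun D h2.
  by apply: measurable_funM => //; exact: measurable_fun_mellin.
have mh : measurable_fun D h.
  by apply: measurable_funD => //; apply: measurable_funM.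
have mellin_ge0 v M x : (forall t, 0 < t -> 0 <= v t) -> 0 <= mellin v M x.
  move=> v0; apply: Rintegral_ge0 => t /=; rewrite in_itv/= andbT => /v0 vt.
  by rewrite mulr_ge0 ?powR_ge0.
have h1_ge0 x : 0 <= h1 x by apply: mulr_ge0; [exact: mellin_ge0|exact: powR_ge0].
have h2_ge0 x : 0 <= h2 x by apply: mulr_ge0; [exact: mellin_ge0|exact: powR_ge0].
have h_ge0 x : 0 <= h x by apply: addr_ge0 => //; apply: mulr_ge0 => //; exact: ltW.
have inth n : (\int[lebesgue_measure]_(x in `]d n, d n.+1[) (h x)%:E =
    (f (d n) - f (d n.+1))%:E)%E.
  apply: integral_mellinM => //.
  - exact: d_gt0.
  - by move=> z dz; apply: iw; exact: le_trans dz.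
  - by move=> z dz; apply: iw1; exact: le_lt_trans dz.
have SE n x : d n <= x -> x < d n.+1 -> S x = (~~ odd n)%:R.
  move=> nx xn.
  have x0 : 0 <= x by exact: le_trans (ltW (d_gt0 _ (d_ge n))) nx.
  (* [cinv] is known only on values of [c], so [x] is first written as [c y] by surjectivity;
     monotonicity of [c] then places [y] in [[n+1, n+2)]. *)
  have [y] : exists2 y, 0 <= y & c y = x.
    have [_ _ /(_ x)] := hc_bij; rewrite /= !in_itv/= !andbT => /(_ x0)[y].
    by rewrite /= in_itv/= andbT => y0 yx; exists y.
  move=> y0 yx; rewrite /S -yx hcinv// (_ : Num.floor y = n.+1); last first.
    have ny : n.+1%:R <= y.
      by rewrite leNgt; apply/negP => /(hc_incr _ _ y0); rewrite hc_cs// yx ltNge nx.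
    have yn : y < n.+2%:R.
      rewrite ltNge le_eqVlt; apply/negP => /orP[/eqP ny2|/(hc_incr _ _ (ler0n _ _))].
        by move: xn; rewrite -yx -ny2 hc_cs// ltxx.
      by rewrite hc_cs// yx ltNge (ltW xn).
    by apply: floor_def; rewrite -PoszD addn1 -!pmulrn ny.
  by rewrite sin_sqr_half_pi.
have termE k : alt_mathieu_term a A b B alpha beta cs lambda mu r k.+1 = (-1) ^+ k * f (d k).
  rewrite /alt_mathieu_term /f -VE// !powRN/= /d -/L; ring.
pose K := limn (fun n : nat =>
  \sum_(1 <= j < n) alt_mathieu_term a A b B alpha beta cs lambda mu r j).
have cvgK : \sum_(0 <= k < n) (-1) ^+ k * f (d k) @[n --> \oo] --> K.
  rewrite -/(cvg_to _ _) (_ : (fun n => _) = (fun n => \sum_(1 <= j < n.+1)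
      alt_mathieu_term a A b B alpha beta cs lambda mu r j)).
    by rewrite (cvg_shiftS (fun n => \sum_(1 <= j < n) _ j)); exact: hK.
  by apply/funext => n; rewrite big_add1/=; apply: eq_bigr => k _; rewrite termE.
have mS := @measurable_fun_step R S d d_oo SE.
have intS := @integral_stepM R f h S d K d_lt d_oo mh (fun x _ => h_ge0 x) inth SE cvgK.
have S0 x : 0 <= S x by exact: sqr_ge0.
have Sh0 x : 0 <= S x * h x by apply: mulr_ge0.
have Sh1 x : 0 <= S x * h1 x by apply: mulr_ge0.
have Sh2 x : 0 <= S x * h2 x by apply: mulr_ge0.
(* The integrand is nonnegative and its integral is the finite number [K]. *)
have iSh : (@lebesgue_measure R).-integrable D (EFin \o fun x => S x * h x).
  apply/integrableP; split.
    by apply/measurable_EFinP; exact: measurable_funM.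
  apply: le_lt_trans (ltry K); rewrite -intS le_eqVlt; apply/orP; left; apply/eqP.
  by apply: eq_integral => x _; rewrite /= (ger0_norm (Sh0 x)).
(* Both summands of [h] are nonnegative, so [S h1] is dominated by [S h] and, below, [S h2] by
   [S h / mu]. This gives each integral its own convergence, which is needed to split the sum. *)
have iS1 : (@lebesgue_measure R).-integrable D (EFin \o fun x => S x * h1 x).
  apply: le_integrable iSh => //.
    by apply/measurable_EFinP; exact: measurable_funM.
  move=> x _; rewrite /= lee_fin (ger0_norm (Sh1 x)) (ger0_norm (Sh0 x)).
  by apply: ler_wpM2l => //; rewrite lerDl; apply: mulr_ge0 => //; exact: ltW.
have iS2 : (@lebesgue_measure R).-integrable D (EFin \o fun x => S x * h2 x).
  apply: le_integrable (integrableZl _ (mu^-1) iSh) => //.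
    by apply/measurable_EFinP; exact: measurable_funM.
  move=> x _; rewrite /= lee_fin (ger0_norm (Sh2 x)) normrM (ger0_norm (Sh0 x)).
  rewrite gtr0_norm ?invr_gt0// (mulrCA mu^-1 (S x)); apply: ler_wpM2l => //.
  by rewrite ler_pdivlMl// lerDr.
have KE1 x : D x -> KV_integrand a A b B alpha beta cinv r (lambda + 1) mu x = S x * h1 x.
  move=> Dx; rewrite /KV_integrand /h1 -VE1; last by move: Dx; rewrite /D/= in_itv/= andbT.
  by rewrite powRN invfM /S; ring.
have KE2 x : D x -> KV_integrand a A b B alpha beta cinv r lambda (mu + 1) x = S x * h2 x.
  move=> Dx; rewrite /KV_integrand /h2 -VE; last by move: Dx; rewrite /D/= in_itv/= andbT => /ltW.
  by rewrite powRN invfM /S; ring.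
split.
- by apply: eq_integrable iS1 => // x /set_mem Dx; rewrite /= KE1.
- by apply: eq_integrable iS2 => // x /set_mem Dx; rewrite /= KE2.
have -> : KV a A b B alpha beta cinv (cs 1%N) r (lambda + 1) mu =
    \int[lebesgue_measure]_(x in D) (S x * h1 x).
  by apply: eq_Rintegral => x /set_mem /KE1.
have -> : KV a A b B alpha beta cinv (cs 1%N) r lambda (mu + 1) =
    \int[lebesgue_measure]_(x in D) (S x * h2 x).
  by apply: eq_Rintegral => x /set_mem /KE2.
rewrite -[LHS]/K.
rewrite -RintegralZl// -RintegralD//; last first.
  by apply: eq_integrable (integrableZl _ mu iS2).
transitivity (fine (\int[lebesgue_measure]_(x in D) (S x * h x)%:E)); first by rewrite intS.
by apply: eq_Rintegral => x _; rewrite /h; ring.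
Qed.
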